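(* If $G$ is an $n$-vertex bipartite graph with a vertex of degree greater than $\lceil \frac{n}{2} \rceil$, then $G$ is not Schur-positive. In particular, if $T$ is an $n$-vertex tree with a vertex of degree greater than $\lceil \frac{n}{2} \rceil$, then $T$ is not Schur-positive.
   Context: All graphs are finite and simple. An $n$-vertex graph has exactly $n$ vertices. A proper colouring of $G$ is a map $\kappa:V_G\to\{1,2,\ldots\}$ with $\kappa(u)\neq\kappa(v)$ whenever $u,v$ are adjacent. A graph is bipartite if it has a proper colouring with 2 colours. If $V_G=\{v_1,\ldots,v_n\}$, the chromatic symmetric function is $X_G=\sum_\kappa x_{\kappa(v_1)}\cdots x_{\kappa(v_n)}\in\mathbb{Q}[[x_1,x_2,\ldots]]$, summed over all proper colourings $\kappa$ of $G$. The elementary symmetric functions are $e_i=\sum_{j_1<\cdots<j_i}x_{j_1}\cdots x_{j_i}$ for $i\ge 1$, with $e_0=1$ and $e_k=0$ for $k<0$. For a partition $\lambda=(\lambda_1,\ldots,\lambda_\ell)$ with transpose $\lambda^t$ (where $\lambda^t_i$ is the number of parts of $\lambda$ that are $\geq i$), the Schur function is $s_\lambda=\det\left(e_{\lambda^t_i-i+j}\right)_{1\le i,j\le\lambda_1}$. The Schur functions form a basis of the algebra of symmetric functions over $\mathbb{Q}$. The graph $G$ is Schur-positive if $X_G$ is a nonnegative linear combination of Schur functions $s_\lambda$. *)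

(* Defs.v *)
From HB Require Import structures.
From mathcomp Require Import all_boot all_order all_algebra.
From mathcomp Require Import finmap multiset.
From mathcomp Require Import boolp classical_sets functions cardinality fsbigop.

Set Implicit Arguments.
Unset Strict Implicit.
Unset Printing Implicit Defensive.
Import Order.TTheory GRing.Theory Num.Theory.
Local Open Scope ring_scope.

(* A monomial is the finite multiset of the indices of its variables, so the
   product of monomials is the multiset sum. The countably many variables are
   numbered from 0 instead of 1. *)
Notation monom := (multiset nat).

Definition series := monom -> rat.
HB.instance Definition _ := GRing.Lmodule.copy series (monom -> rat^o).

Section Divisors.
Local Open Scope mset_scope.

Fixpoint divs_seq (s : seq nat) : seq monom :=
  if s is x :: s' then divs_seq s' ++ [seq x +` a | a <- divs_seq s']
  else [:: mset0].

Definition mdivisors (m : monom) : seq monom := undup (divs_seq (enum_mset m)).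

Lemma divs_seqP s (a : monom) : (a \in divs_seq s) = (a `<=` seq_mset s).
Proof.
elim: s a => [|x s IHs] a /=.
  have -> : seq_mset [::] = mset0 :> {mset nat}.
    by apply/msetP => y; rewrite mset_seqE mset0E.
  by rewrite inE msubset0.
rewrite mem_cat IHs mset_cons; apply/orP/msubsetP => [[/msubsetP as_|]|le_a].
- by move=> y; rewrite mset1DE (leq_trans (as_ y)) ?leq_addl.
- case/mapP=> b; rewrite IHs => /msubsetP bs -> y.
  by rewrite !mset1DE leq_add2l.
have [xa|/mset_eq0P xNa] := boolP (x \in a).
  right; apply/mapP; exists (a `\ x); last by rewrite msetB1K.
  rewrite IHs; apply/msubsetP => y; rewrite msetB1E.
  by rewrite leq_subLR; have := le_a y; rewrite mset1DE.
left; apply/msubsetP => y; have := le_a y; rewrite mset1DE.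
by have [->|_] := eqVneq y x; rewrite ?xNa.
Qed.

Lemma mem_mdivisors (m a : monom) : (a \in mdivisors m) = (a `<=` m).
Proof. by rewrite mem_undup divs_seqP seq_mset_id. Qed.

Lemma mdivisors_uniq m : uniq (mdivisors m).
Proof. exact: undup_uniq. Qed.

End Divisors.

Definition mul_series (f g : series) : series :=
  fun m => \sum_(a <- mdivisors m) f a * g (m `\` a)%mset.

Definition one_series : series := fun m => (m == mset0)%:R.

Section RingAxioms.
Implicit Types (f g h : series) (m a b : monom).

Lemma big_mdivisors_sub m b (F : monom -> rat) : (b `<=` m)%mset ->
  \sum_(a <- mdivisors b) F a = \sum_(a <- mdivisors m | (a `<=` b)%mset) F a.
Proof.
move=> bm; rewrite -[RHS]big_filter; apply: perm_big; apply: uniq_perm.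
- exact: mdivisors_uniq.
- by rewrite filter_uniq ?mdivisors_uniq.
move=> a; rewrite mem_filter !mem_mdivisors; case ab: (a `<=` b)%mset => //=.
by rewrite (msubset_trans ab bm).
Qed.

Lemma big_mdivisors_ge m a (F : monom -> rat) : (a `<=` m)%mset ->
  \sum_(b <- mdivisors m | (a `<=` b)%mset) F b =
  \sum_(c <- mdivisors (m `\` a)%mset) F (a `+` c)%mset.
Proof.
move=> am; rewrite -[LHS]big_filter -[RHS](big_map (msetD a) xpredT F).
apply: perm_big; apply: uniq_perm.
- by rewrite filter_uniq ?mdivisors_uniq.
- rewrite map_inj_uniq ?mdivisors_uniq // => c d /msetP ecd; apply/msetP => x.
  by have := ecd x; rewrite !msetE2 => /addnI.
move=> b; rewrite mem_filter mem_mdivisors; apply/andP/mapP => [[ab bm]|[c]].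
  exists (b `\` a)%mset; last by rewrite msetBDKC.
  by rewrite mem_mdivisors msetSB.
rewrite mem_mdivisors => /msubsetP cm ->; split.
  by apply/msubsetP => x; rewrite msetE2 leq_addr.
apply/msubsetP => x; have := cm x; rewrite !msetE2 => cx.
by rewrite -(subnKC (msubsetP am x)) leq_add2l.
Qed.

Lemma mul_seriesC : commutative mul_series.
Proof.
move=> f g; apply/funext => m; rewrite /mul_series.
have p : perm_eq (mdivisors m) [seq (m `\` a)%mset | a <- mdivisors m].
  apply: uniq_perm; first exact: mdivisors_uniq.
    rewrite map_inj_in_uniq ?mdivisors_uniq // => a b.
    rewrite !mem_mdivisors => am bm e.
    by rewrite -(msetBBK am) e msetBBK.
  move=> a; rewrite mem_mdivisors; apply/idP/mapP => [am|[b _ ->]].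
    exists (m `\` a)%mset; last by rewrite msetBBK.
    by rewrite mem_mdivisors msubsetDl.
  exact: msubsetDl.
rewrite (perm_big _ p) /= big_map big_seq [RHS]big_seq; apply: eq_bigr => a.
by rewrite mem_mdivisors => am; rewrite msetBBK // mulrC.
Qed.

Lemma mul_seriesA : associative mul_series.
Proof.
move=> f g h; apply/funext => m; rewrite /mul_series.
transitivity (\sum_(a <- mdivisors m) \sum_(b <- mdivisors m | (a `<=` b)%mset)
    f a * g (b `\` a)%mset * h (m `\` b)%mset).
  rewrite big_seq [RHS]big_seq; apply: eq_bigr => a; rewrite mem_mdivisors => am.
  rewrite big_mdivisors_ge // mulr_sumr; apply: eq_bigr => c _.
  rewrite mulrA; congr (_ * g _ * h _); last by rewrite msetBDA.
  by apply/msetP => x; rewrite !msetE2 addKn.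
rewrite (exchange_big_dep xpredT) //= big_seq [RHS]big_seq.
apply: eq_bigr => b; rewrite mem_mdivisors => bm.
by rewrite mulr_suml (big_mdivisors_sub _ bm).
Qed.

Lemma mul_1series : left_id one_series mul_series.
Proof.
move=> f; apply/funext => m; rewrite /mul_series /one_series.
rewrite (bigD1_seq mset0) ?mdivisors_uniq ?mem_mdivisors ?msub0set //=.
rewrite eqxx mul1r msetB0 big1 ?addr0 // => a /negbTE ->.
by rewrite mul0r.
Qed.

Lemma mul_seriesDl : left_distributive mul_series +%R.
Proof.
move=> f g h; apply/funext => m.
transitivity (\sum_(a <- mdivisors m)
    (f a * h (m `\` a)%mset + g a * h (m `\` a)%mset)).
  by apply: eq_bigr => a _; exact: mulrDl.
exact: big_split.
Qed.

Lemma one_series_neq0 : one_series != 0.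
Proof.
apply/eqP => /(congr1 (fun f : series => f mset0)).
by rewrite /one_series eqxx => /eqP; rewrite oner_eq0.
Qed.

End RingAxioms.

HB.instance Definition _ := GRing.Zmodule_isComNzRing.Build series
  mul_seriesA mul_seriesC mul_1series mul_seriesDl one_series_neq0.

Definition var (i : nat) : series := fun m => (m == [mset i]%mset)%:R.

(* Coefficientwise sum of a family of series. [\sum_(i \in D)] is 0 when
   infinitely many terms are nonzero. This never happens in [elem] and
   [chromatic_sym]: only finitely many index sets or colourings yield a given
   monomial. *)
Definition series_sum (I : choiceType) (D : set I) (F : I -> series) : series :=
  fun m => \sum_(i \in D) F i m.

Definition elem (i : nat) : series :=
  series_sum [set A : {fset nat} | #|` A|%fset = i]%classic
             (fun A => \prod_(j <- enum_fset A) var j).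

Definition elemz (k : int) : series := if k is Posz i then elem i else 0.

Record partition_of_nat := Partition {
  parts :> seq nat;
  _ : sorted geq parts && (0 \notin parts)%N }.

(* The transpose, indexed from 0: number of parts that are at least i + 1. *)
Definition transpose_part (la : seq nat) (i : nat) : nat :=
  count (fun p => i.+1 <= p)%N la.

(* The determinant has size la_1, the largest part (0 for the empty
   partition); shifting both indices to start at 0 leaves - i + j unchanged. *)
Definition schur (la : partition_of_nat) : series :=
  \det (\matrix_(i < head 0%N la, j < head 0%N la)
          elemz ((transpose_part la i)%:Z - i%:Z + j%:Z)).

Record sgraph := SGraph {
  vertex :> finType;
  adj : rel vertex;
  adj_sym : symmetric adj;
  adj_irr : irreflexive adj }.

Definition degree (G : sgraph) (v : G) : nat := #|[set w | adj v w]|.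

(* Colours are numbered from 0, like the variables. *)
Definition proper_colouring (G : sgraph) (k : {ffun G -> nat}) : Prop :=
  forall u v : G, adj u v -> k u <> k v.

Definition bipartite (G : sgraph) : Prop :=
  exists k : {ffun G -> nat}, proper_colouring k /\ forall v, (k v < 2)%N.

Definition connected_graph (G : sgraph) : Prop :=
  forall u v : G, connect (@adj G) u v.

Definition acyclic (G : sgraph) : Prop :=
  forall s : seq G, (2 < size s)%N -> ~ ucycle (@adj G) s.

Definition is_tree (G : sgraph) : Prop := connected_graph G /\ acyclic G.

Definition chromatic_sym (G : sgraph) : series :=
  series_sum [set k | @proper_colouring G k]%classic
             (fun k => \prod_(v : G) var (k v)).

Definition schur_positive (G : sgraph) : Prop :=
  exists (s : seq partition_of_nat) (c : partition_of_nat -> rat),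
    (forall la, 0 <= c la) /\
    chromatic_sym G = \sum_(la <- s) c la *: schur la.

(* Main.v *)
Require Import Defs.
From mathcomp Require Import all_boot.
From HB Require Import structures.
From mathcomp Require Import all_order all_algebra.
From mathcomp Require Import finmap multiset.
From mathcomp Require Import boolp classical_sets cardinality fsbigop.
From mathcomp Require Import zify ring.

Set Implicit Arguments.
Unset Strict Implicit.
Unset Printing Implicit Defensive.

(** Suppose that a bipartite graph on [n] vertices is Schur-positive, and set
    every variable except [x_0] and [x_1] to zero in its chromatic symmetric
    function. The coefficient of [x_0 ^ i * x_1 ^ j] then counts the proper
    2-colourings with [i] vertices of colour 0 and [j] of colour 1.

    On the Schur side, [s_la] vanishes in two variables if [la] has more than
    two parts, and otherwise it is
    [(x_0 x_1) ^ la_2 * \sum_(i + j = la_1 - la_2) x_0 ^ i x_1 ^ j]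
    ([det_jacobi_trudi2]). Hence its coefficient at [x_0 ^ i * x_1 ^ j] is 1
    if [i + j = la_1 + la_2] and both [i] and [j] are at least [la_2], and 0
    otherwise ([schur_mon2]): among the monomials of degree [n], the balanced
    one, with exponents [uphalf n] and [n./2], has the largest coefficient
    ([schur_mon2_le]). Nonnegative combinations inherit this inequality.

    A bipartition makes some coefficient of degree [n] positive, so the
    balanced one is positive too: there is a balanced proper 2-colouring
    ([schur_positive_balanced]). All the neighbours of a vertex lie in the
    colour class opposite to it, which has at most [uphalf n] elements, so no
    degree exceeds [uphalf n] ([bipartite_degree_le]).

    For trees it remains to see that they are bipartite ([tree_bipartite]).
    Colour each vertex by the parity of a walk from a fixed root: an edge
    joining two vertices of the same colour closes an odd walk, and an odd
    closed walk contains an odd cycle ([odd_cycle_ucycle]). *)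

Section SymmetricFunctions.
Import Order.TTheory GRing.Theory Num.Theory.
Local Open Scope ring_scope.
Implicit Types (f g : series) (m : monom).

(** * Coefficients of products of variables *)

Lemma series_mulE f g m :
  (f * g) m = \sum_(a <- mdivisors m) f a * g (m `\` a)%mset.
Proof. by []. Qed.

Lemma series_oneE m : (1 : series) m = (m == mset0)%:R.
Proof. by []. Qed.

Lemma series_addE f g m : (f + g) m = f m + g m.
Proof. by []. Qed.

Lemma series_oppE f m : (- f) m = - f m.
Proof. by []. Qed.

Lemma series_scaleE (c : rat) f m : (c *: f) m = c * f m.
Proof. by []. Qed.

Lemma series_sumE (I : Type) (r : seq I) (F : I -> series) m :
  (\sum_(i <- r) F i) m = \sum_(i <- r) F i m.
Proof. by apply: (big_morph (fun f : series => f m)). Qed.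

Lemma var_mulE x f m :
  (var x * f) m = if x \in m then f (m `\ x)%mset else 0.
Proof.
rewrite series_mulE /var; case: ifPn => [xm|xNm].
  rewrite (bigD1_seq [mset x]%mset) ?mdivisors_uniq //=; last first.
    rewrite mem_mdivisors; apply/msubsetP => y; rewrite msetnE.
    by case: eqVneq => // ->; rewrite mset_gt0.
  by rewrite eqxx mul1r big1 ?addr0 // => a /negbTE ->; rewrite mul0r.
rewrite big_seq big1 // => a; rewrite mem_mdivisors => am.
case: eqVneq => [ea|_]; rewrite ?mul0r //.
by case/negP: xNm; apply: (msubset_subset am); rewrite ea in_mset1.
Qed.

Lemma prod_varE (I : Type) (r : seq I) (k : I -> nat) m :
  (\prod_(i <- r) var (k i)) m = (m == seq_mset (map k r))%:R.
Proof.
elim: r m => [|i r IHr] m.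
  rewrite big_nil series_oneE; congr (_ == _)%:R.
  by apply/msetP => x; rewrite mset_seqE mset0E.
rewrite big_cons var_mulE /= mset_cons IHr; case: ifPn => [im|iNm].
  congr ((_ : bool)%:R); apply/eqP/eqP => [<-|->]; first by rewrite msetB1K.
  by rewrite msetD1K.
by case: eqVneq => // em; rewrite em mset1D1 in iNm.
Qed.

(** The product of the variables indexed by [A] is [m] only if [A] is the support
    of [m], so the sum that defines [elem] has at most one nonzero term. *)
Lemma elemE i m :
  elem i m = ((size (enum_mset m) == i) && uniq (enum_mset m))%:R.
Proof.
rewrite /elem /series_sum.
have coef (A : {fset nat}) : (\prod_(j <- enum_fset A) var j) m
    = (perm_eq (enum_mset m) (enum_fset A))%:R.
  rewrite prod_varE map_id; congr ((_ : bool)%:R).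
  by rewrite -{1}[m]seq_mset_id; apply/eqP/eq_seq_msetP.
have [|no] := boolP (_ && _); last first.
  rewrite fsbig1 // => A /= cardA; rewrite coef.
  case: (boolP (perm_eq _ _)) => // pA; case/negP: no.
  by rewrite (perm_size pA) (perm_uniq pA) fset_uniq andbT; apply/eqP.
case/andP=> /eqP size_m uniq_m; pose A0 := [fset x in enum_mset m]%fset.
have permA0 : perm_eq (enum_mset m) (enum_fset A0).
  by apply: uniq_perm => // x; rewrite inE.
transitivity (\sum_(A \in [set A0]%classic)
    (\prod_(j <- enum_fset A) var j : series) m).
  apply: esym; apply: fsbig_widen => [A -> | A [cardA AA0]] /=.
    by rewrite -(perm_size permA0).
  rewrite coef; case: (boolP (perm_eq _ _)) => // pA; case: AA0.
  by apply/fsetP => x /=; rewrite inE (perm_mem pA).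
by rewrite fsbig_set1 coef permA0.
Qed.

(** * Restriction to two variables *)

(** The result of setting to zero all the variables whose index fails [P].
    Staying inside [series] makes this a ring endomorphism, so that it commutes
    with determinants. *)
Definition restrict (P : pred nat) f : series :=
  fun m => if all P (enum_mset m) then f m else 0.

Lemma all_msetD (P : pred nat) (a b : monom) :
  all P (enum_mset (a `+` b)%mset) = all P (enum_mset a) && all P (enum_mset b).
Proof.
apply/allP/andP => [Pab|[/allP Pa /allP Pb] x].
  by split; apply/allP => x xa; apply: Pab; rewrite in_msetD xa ?orbT.
by rewrite in_msetD => /orP[]; [apply: Pa | apply: Pb].
Qed.

Fact restrict_is_zmod_morphism P : zmod_morphism (restrict P).
Proof.
move=> f g; apply/funext => m; rewrite /restrict.
rewrite !(series_addE, series_oppE).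
by case: ifP => _; rewrite ?subr0.
Qed.

(** The factors of a monomial involve no variable outside [P] if and only if the
    monomial itself does not, so each term of the convolution is either kept on
    both sides or dropped on both. *)
Fact restrict_is_monoid_morphism P : monoid_morphism (restrict P).
Proof.
split=> [|f g]; apply/funext => m; rewrite /restrict.
  by rewrite series_oneE; case: eqVneq => [->|_]; rewrite ?enum_mset0 ?if_same.
rewrite !series_mulE /=.
transitivity (\sum_(a <- mdivisors m)
   if all P (enum_mset m) then f a * g (m `\` a)%mset else 0).
  by case: ifP => // _; rewrite big1.
rewrite big_seq [RHS]big_seq; apply: eq_bigr => a; rewrite mem_mdivisors => am.
rewrite -{1}(msetBDKC am) all_msetD.
by do 2!case: (all P _); rewrite /= ?mul0r ?mulr0.
Qed.

HB.instance Definition _ P :=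
  GRing.isZmodMorphism.Build series series (restrict P)
    (restrict_is_zmod_morphism P).
HB.instance Definition _ P :=
  GRing.isMonoidMorphism.Build series series (restrict P)
    (restrict_is_monoid_morphism P).

Definition mon2 (i j : nat) : monom := seq_mset (nseq i 0%N ++ nseq j 1%N).

Lemma mon2E i j x :
  mon2 i j x = (if x == 0 then i else if x == 1 then j else 0)%N.
Proof.
rewrite mset_seqE count_cat !count_nseq.
by case: x => [|[|x]] /=; rewrite ?mul1n ?mul0n ?addn0.
Qed.

Lemma all_lt2_mon2 i j : all (fun x => x < 2)%N (enum_mset (mon2 i j)).
Proof.
apply/allP => x; rewrite in_mset mon2E.
by case: x => [|[|x]].
Qed.

Lemma all_lt2_mset m : all (fun x => x < 2)%N (enum_mset m) ->
  m = mon2 (m 0%N) (m 1%N).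
Proof.
move=> /allP lt2; apply/msetP => x; rewrite mon2E.
case: x => [|[|x]] //=; apply/eqP; rewrite mset_eq0.
by apply/negP => /lt2.
Qed.

Lemma size_mon2 i j : size (enum_mset (mon2 i j)) = (i + j)%N.
Proof.
by rewrite (perm_size (perm_eq_seq_mset _)) size_cat !size_nseq.
Qed.

Lemma uniq_mon2 i j : uniq (enum_mset (mon2 i j)) = (i <= 1)%N && (j <= 1)%N.
Proof.
rewrite (perm_uniq (perm_eq_seq_mset _)).
by case: i j => [|[|i]] [|[|j]]; rewrite //= ?andbF.
Qed.

Notation restrict2 := (restrict (fun x => x < 2)%N).

(** Turns statements about the coefficients at all [mon2 i j] into equations in
    the ring [series], and back. *)
Lemma eq_restrict2 f g :
  (forall i j, f (mon2 i j) = g (mon2 i j)) <-> restrict2 f = restrict2 g.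
Proof.
split=> [efg|efg i j].
  apply/funext => m; rewrite /restrict; case: ifP => // /all_lt2_mset ->.
  exact: efg.
have := congr1 (fun h : series => h (mon2 i j)) efg.
by rewrite /restrict all_lt2_mon2.
Qed.

Lemma var0_mul_mon2 f i j :
  (var 0 * f) (mon2 i j) = if i is i'.+1 then f (mon2 i' j) else 0.
Proof.
rewrite var_mulE -mset_gt0 mon2E; case: i => //= i; congr f.
by apply/msetP => x; rewrite msetB1E !mon2E; case: x => [|x] /=; lia.
Qed.

Lemma var1_mul_mon2 f i j :
  (var 1 * f) (mon2 i j) = if j is j'.+1 then f (mon2 i j') else 0.
Proof.
rewrite var_mulE -mset_gt0 mon2E; case: j => //= j; congr f.
by apply/msetP => x; rewrite msetB1E !mon2E; case: x => [|[|x]] /=; lia.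
Qed.

Lemma one_mon2 i j : (1 : series) (mon2 i j) = ((i == 0) && (j == 0))%N%:R.
Proof.
rewrite series_oneE; congr ((_ : bool)%:R).
apply/eqP/andP => [e|[/eqP -> /eqP ->]].
  by have := mon2E i j 0; have := mon2E i j 1; rewrite e !mset0E /= => <- <-.
by apply/msetP => x; rewrite mon2E mset0E; case: x => [|[|x]].
Qed.

Lemma var0_mon2 i j : var 0 (mon2 i j) = ((i == 1) && (j == 0))%N%:R.
Proof.
by rewrite -[var 0]mulr1 var0_mul_mon2; case: i => [|i]; rewrite ?one_mon2.
Qed.

Lemma var1_mon2 i j : var 1 (mon2 i j) = ((i == 0) && (j == 1))%N%:R.
Proof.
by rewrite -[var 1]mulr1 var1_mul_mon2; case: j => [|j]; rewrite ?one_mon2 ?andbF.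
Qed.

(** The elementary symmetric polynomials in two variables, extended by zero to
    all integer indices. *)
Definition elem2 (R : comNzRingType) (x y : R) (z : int) : R :=
  match z with
  | Posz 0 => 1 | Posz 1 => x + y | Posz 2 => x * y | _ => 0
  end.

Lemma restrict2_elem z :
  restrict2 (elemz z) = restrict2 (elem2 (var 0) (var 1) z).
Proof.
apply/eq_restrict2 => i j; case: z => [n|//]; rewrite /elemz elemE size_mon2.
rewrite uniq_mon2.
case: n => [|[|[|n]]]; rewrite /elem2 ?one_mon2.
- by case: i j => [|i] [|j].
- rewrite series_addE var0_mon2 var1_mon2 -natrD; congr _%:R.
  by case: i j => [|[|i]] [|[|j]].
- rewrite var0_mul_mon2; case: i => [|i]; first by case: j => [|[|[|j]]].
  rewrite var1_mon2; congr ((_ : bool)%:R).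
  by case: i j => [|i] [|[|j]]; rewrite ?andbF.
- by case: i j => [|[|i]] [|[|j]]; rewrite ?andbF.
Qed.

(** * The Jacobi-Trudi determinant in two variables *)

Section TwoRowDeterminant.
Variables (R : comNzRingType) (x y : R).

(** The complete homogeneous polynomial [\sum_(i + j = n) x ^ i * y ^ j]. *)
Fixpoint hom2 n : R := if n is n'.+1 then x * hom2 n' + y ^+ n'.+1 else 1.

(** The matrix that defines a Schur function, with [t] for the transpose of the
    partition and [x], [y] for the only variables. *)
Definition jacobi_trudi2 (t : nat -> nat) n : 'M[R]_n :=
  \matrix_(i < n, j < n) elem2 x y ((t i)%:Z - i%:Z + j%:Z).

(** The matrix is tridiagonal, with [x + y] on the diagonal, [x * y] above and 1
    below, so its determinant obeys
    [D (n + 2) = (x + y) * D (n + 1) - x * y * D n], as does [hom2]. *)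
Lemma det_jacobi_trudi2_one_row n : \det (jacobi_trudi2 (fun=> 1%N) n) = hom2 n.
Proof.
suff: \det (jacobi_trudi2 (fun=> 1%N) n) = hom2 n /\
      \det (jacobi_trudi2 (fun=> 1%N) n.+1) = hom2 n.+1 by case.
elim: n => [|n [IHn IHn1]].
  by rewrite det_mx00 det_mx11 mxE /= mulr1.
split=> //; rewrite (expand_det_row _ ord0) !big_ord_recl.
rewrite big1 => [|j _]; last by rewrite mxE /= mul0r.
rewrite !mxE /= addr0 /cofactor /=.
have -> : row' ord0 (col' ord0 (jacobi_trudi2 (fun=> 1%N) n.+2))
    = jacobi_trudi2 (fun=> 1%N) n.+1.
  by apply/matrixP => i j; rewrite !mxE; congr elem2; rewrite /= /bump /=; lia.
rewrite IHn1 (expand_det_col _ ord0) big_ord_recl big1 => [|i _]; last first.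
  rewrite !mxE [X in elem2 _ _ X](_ : _ = - (i.+1)%:Z) ?mul0r //.
  by rewrite /= /bump /=; lia.
rewrite /cofactor !mxE.
have -> : row' ord0 (col' ord0 (row' ord0 (col' (lift ord0 ord0)
      (jacobi_trudi2 (fun=> 1%N) n.+2)))) = jacobi_trudi2 (fun=> 1%N) n.
  apply/matrixP => i j; rewrite !mxE; congr elem2.
  by rewrite /= /bump /=; lia.
rewrite IHn /= /bump /=.
rewrite !(addn0, add0n) expr0 expr1 !exprS.
ring.
Qed.

(** In each of the first [b] rows the diagonal entry [x * y] is the last nonzero
    one, as the elementary polynomials of index above 2 vanish. Expanding along
    these rows strips off a factor [x * y] each. *)
Lemma det_jacobi_trudi2 b k :
  \det (jacobi_trudi2 (fun i => (i < b)%N.+1) (b + k)) = (x * y) ^+ b * hom2 k.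
Proof.
elim: b => [|b IHb]; first by rewrite det_jacobi_trudi2_one_row mul1r.
rewrite (expand_det_row _ ord0) big_ord_recl big1 => [|j _]; last first.
  by rewrite mxE /= mul0r.
rewrite mxE /= addr0 /cofactor /= expr0 mul1r exprS -mulrA; congr (_ * _).
rewrite -IHb; congr (\det _); apply/matrixP => i j; rewrite !mxE; congr elem2.
rewrite /= /bump /= !add1n ltnS; case: i j => [i _] [j _] /=.
by case: (i < b)%N => /=; lia.
Qed.

End TwoRowDeterminant.

(** * Schur functions in two variables *)

Lemma var1X_mon2 k i j :
  (var 1 ^+ k : series) (mon2 i j) = ((i == 0) && (j == k))%N%:R.
Proof.
elim: k j => [|k IHk] j; first by rewrite expr0 one_mon2.
by rewrite exprS var1_mul_mon2; case: j => [|j]; rewrite ?andbF ?IHk.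
Qed.

Lemma hom2_mon2 k i j :
  hom2 (var 0) (var 1) k (mon2 i j) = (i + j == k)%N%:R.
Proof.
elim: k i j => [|k IHk] i j; first by rewrite [hom2 _ _ _]/= one_mon2 addn_eq0.
rewrite [hom2 _ _ _]/= series_addE var0_mul_mon2 var1X_mon2.
by case: i => [|i]; rewrite ?add0r ?addr0 ?IHk.
Qed.

Lemma two_row_schur_mon2 b k i j :
  ((var 0 * var 1) ^+ b * hom2 (var 0) (var 1) k) (mon2 i j) =
  [&& i + j == b + (b + k), b <= i & b <= j]%N%:R.
Proof.
elim: b i j => [|b IHb] i j; first by rewrite mul1r hom2_mon2 !andbT.
rewrite exprS -!mulrA var0_mul_mon2; case: i => [|i]; first by rewrite andbF.
rewrite var1_mul_mon2; case: j => [|j]; first by rewrite !andbF.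
by rewrite IHb; congr ((_ : bool)%:R); lia.
Qed.

Lemma schur_restrict2 (la : partition_of_nat) :
  restrict2 (schur la) =
  restrict2 (\det (jacobi_trudi2 (var 0) (var 1)
                    (transpose_part la) (head 0%N la))).
Proof.
rewrite /schur -!det_map_mx; congr (\det _); apply/matrixP => i j.
by rewrite !mxE; apply: restrict2_elem.
Qed.

(** With at most two parts, the transpose of [la] has its first [la_2] entries
    equal to 2 and the next [la_1 - la_2] equal to 1, so [det_jacobi_trudi2]
    applies. With three parts or more, the first row of the determinant only has
    elementary polynomials of index at least 3, which vanish. *)
Lemma schur_mon2 (la : partition_of_nat) i j :
  schur la (mon2 i j) =
  [&& size la <= 2, i + j == nth 0 la 0 + nth 0 la 1,
      nth 0 la 1 <= i & nth 0 la 1 <= j]%N%:R.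
Proof.
have /eq_restrict2 -> := schur_restrict2 la; move: i j.
case: la => -[|a [|b [|c s]]] /=.
- by move=> _ i j; rewrite det_mx00 one_mon2 addn_eq0 !andbT.
- rewrite inE eq_sym -lt0n => a_gt0 i j; rewrite addn0 /=.
  rewrite -(two_row_schur_mon2 0 a) mul1r -det_jacobi_trudi2_one_row.
  congr ((determinant _ : series) _); apply/matrixP => r r'.
  rewrite !mxE /transpose_part /=.
  by rewrite addn0 ltn_ord.
- rewrite !inE andbT negb_or => /and3P[leba _ _] i j.
  have [k def_a] : exists k, a = (b + k)%N by exists (a - b)%N; rewrite subnKC.
  rewrite {leba}def_a (addnC (b + k)%N) -two_row_schur_mon2 -det_jacobi_trudi2.
  congr ((determinant _ : series) _); apply/matrixP => r r'.
  rewrite !mxE /transpose_part /=.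
  by rewrite addn0 ltn_ord.
rewrite !inE !negb_or !(eq_sym 0%N) -!lt0n.
case/andP=> [/and3P[leba lecb _] /and4P[a0 b0 c0 _]] i j.
case: a a0 leba => // a _ leba; rewrite (expand_det_row _ ord0) big1 // => r _.
rewrite mxE /transpose_part /= b0 c0.
by rewrite mul0r.
Qed.

(** If [la_2] is at most both [i] and [j], then it is at most [n./2], the smaller
    exponent of the balanced monomial. *)
Lemma schur_mon2_le (la : partition_of_nat) n i j : (i + j = n)%N ->
  schur la (mon2 i j) <= schur la (mon2 (uphalf n) n./2).
Proof.
by move=> ijn; rewrite !schur_mon2 ler_nat; case: and4P => // -[]; lia.
Qed.

(** * The chromatic symmetric function in two variables *)

Section ChromaticCoefficients.
Variable G : sgraph.
Implicit Types k : {ffun G -> nat}.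

Definition colour_class k (c : nat) : {set G} := finset (fun v => k v == c).

Lemma colouring_mon2 k i j :
  (\prod_(v : G) var (k v)) (mon2 i j) =
  [&& [forall v, k v < 2], #|colour_class k 0| == i
   & #|colour_class k 1| == j]%N%:R.
Proof.
rewrite prod_varE; congr ((_ : bool)%:R).
have card_class c : #|colour_class k c| = count_mem c (map k (index_enum G)).
  by rewrite -sum1dep_card sum1_count count_map.
apply/eqP/and3P => [e|[/forallP lt2 /eqP <- /eqP <-]].
  rewrite !card_class -!mset_seqE -e !mon2E !eqxx; split=> //.
  apply/forallP => v; apply: (allP (all_lt2_mon2 i j)).
  rewrite e (perm_mem (perm_eq_seq_mset _)).
  by apply: map_f; rewrite mem_index_enum.
apply/msetP => c; rewrite mon2E mset_seqE !card_class.
case: c => [|[|c]] //=; apply/esym/eqP; rewrite -leqn0 leqNgt -has_count.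
by apply/hasPn => _ /mapP[v _ ->] /=; have := lt2 v; case: (k v) => [|[|]].
Qed.

Lemma chromatic_mon2_gt0 k : proper_colouring k -> (forall v, k v < 2)%N ->
  0 < chromatic_sym G (mon2 #|colour_class k 0| #|colour_class k 1|).
Proof.
move=> k_proper lt2; rewrite /chromatic_sym /series_sum fsbig_supp.
rewrite (fsbigD1 k) /=; first last.
- split=> //; rewrite colouring_mon2 !eqxx andbT.
  by rewrite (introT forallP lt2); apply/eqP; rewrite oner_eq0.
- (* The sum over the colourings is only meaningful if finitely many of them
     contribute: those that do take their values in {0, 1}. *)
  apply: (@sub_finite_set _ _
    (range (fun h : {ffun G -> 'I_2} => [ffun v => h v : nat]))); last first.
    by apply: finite_image; apply: finite_finset.
  move=> k' [_] /=; rewrite colouring_mon2.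
  case: forallP => // lt2' _; exists [ffun v => Ordinal (lt2' v)] => //.
  by apply/ffunP => v; rewrite !ffunE.
apply: ltr_wpDr; last by rewrite colouring_mon2 !eqxx andbT (introT forallP lt2).
by apply: fsumr_ge0 => k' _; rewrite colouring_mon2 ler0n.
Qed.

Lemma chromatic_mon2_colouring i j : 0 < chromatic_sym G (mon2 i j) ->
  exists k, [/\ proper_colouring k, forall v, (k v < 2)%N,
                #|colour_class k 0| = i & #|colour_class k 1| = j].
Proof.
case/(fsumr_gt0 [::]) => k k_proper; rewrite colouring_mon2.
by case: and3P => // -[/forallP lt2 /eqP card0 /eqP card1] _; exists k.
Qed.

Lemma card_colour_classes k : (forall v, k v < 2)%N ->
  (#|colour_class k 0| + #|colour_class k 1|)%N = #|G|.
Proof.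
move=> lt2; rewrite -(cardsC (colour_class k 0)); congr (_ + _)%N.
apply: eq_card => v; rewrite !inE.
by have := lt2 v; case: (k v) => [|[|]].
Qed.

(** A nonnegative combination of Schur functions has its largest coefficient,
    among the monomials [mon2 i j] of degree [#|G|], at the balanced one; here
    this coefficient counts the colourings sought, and the colour classes of the
    bipartition give a monomial of that degree with a positive coefficient. *)
Lemma schur_positive_balanced : schur_positive G -> bipartite G ->
  exists k, [/\ proper_colouring k, forall v, (k v < 2)%N,
    #|colour_class k 0| = uphalf #|G| & #|colour_class k 1| = #|G|./2].
Proof.
move=> [s [c [c_ge0 XG]]] [k [k_proper lt2]].
apply: chromatic_mon2_colouring.
apply: lt_le_trans (chromatic_mon2_gt0 k_proper lt2) _.
rewrite XG !series_sumE; apply: ler_sum => la _; rewrite !series_scaleE.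
by apply: ler_wpM2l => //; apply: schur_mon2_le; apply: card_colour_classes.
Qed.

Lemma bipartite_degree_le : schur_positive G -> bipartite G ->
  forall v : G, (degree v <= uphalf #|G|)%N.
Proof.
move=> pos bip v.
have [k [k_proper lt2 card0 card1]] := schur_positive_balanced pos bip.
(* With colours 0 and 1, the opposite of [k v] is [1 - k v]. *)
have nbr : finset (fun w => adj v w) \subset colour_class k (1 - k v).
  apply/fintype.subsetP => w; rewrite !inE => /k_proper/eqP.
  by have := lt2 v; have := lt2 w; case: (k v) (k w) => [|[|]] // [|[|]].
apply: leq_trans (subset_leq_card nbr) _.
have := lt2 v; case: (k v) => [|[|]] // _; rewrite ?card0 ?card1 //.
by rewrite uphalf_half leq_addl.
Qed.

End ChromaticCoefficients.
End SymmetricFunctions.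

(** * Trees are bipartite *)

Section OddCycles.
Variable G : sgraph.
Implicit Type s : seq G.

Lemma not_uniq_cat (T : eqType) (s : seq T) : ~~ uniq s ->
  exists x p1 p2 p3, s = p1 ++ x :: p2 ++ x :: p3.
Proof.
elim: s => //= x s IHs; rewrite negb_and negbK => /orP[|/IHs].
  by case/splitPr=> p2 p3; exists x, [::], p2, p3.
by case=> y [p1 [p2 [p3 ->]]]; exists y, (x :: p1), p2, p3.
Qed.

(** A closed walk that visits a vertex twice splits there into two shorter closed
    walks; if the walk is odd, one of these is odd too. An odd closed walk that
    repeats no vertex has length at least 3, for there are no loops. *)
Lemma odd_cycle_ucycle s : cycle (@adj G) s -> odd (size s) ->
  exists2 s' : seq G, 2 < size s' & ucycle (@adj G) s'.
Proof.
have [n] := ubnP (size s); elim: n s => // n IHn s lt_s cyc_s odd_s.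
have [uniq_s | /not_uniq_cat[x [p1 [p2 [p3 def_s]]]]] := boolP (uniq s).
  exists s; last by rewrite /ucycle cyc_s.
  by case: s cyc_s odd_s {lt_s uniq_s} => [|x [|y [|z s]]] //=; rewrite adj_irr.
have size_s : size s = size (x :: p2) + size (x :: p3 ++ p1).
  by rewrite def_s; do !rewrite /= ?size_cat; lia.
have [cyc2 cyc31] : cycle (@adj G) (x :: p2) /\ cycle (@adj G) (x :: p3 ++ p1).
  move: cyc_s; rewrite def_s cycle_catC /= -catA rcons_cat cat_path /=.
  by case/and3P=> path2 adj2 path31; rewrite rcons_path path2.
move: lt_s odd_s; rewrite size_s oddD.
have [odd2 lt_s _ | even2 lt_s odd31] := boolP (odd (size (x :: p2))).
  by apply: IHn cyc2 odd2; move: lt_s => /=; lia.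
by apply: IHn cyc31 odd31; move: lt_s => /=; lia.
Qed.

Lemma tree_bipartite : is_tree G -> bipartite G.
Proof.
move=> [conn acyc]; case: (pickP [pred v : G | true]) => [r _|noG]; last first.
  exists [ffun=> 0]; split=> v; first by have := noG v.
  by rewrite ffunE.
have walk v : exists p, path (@adj G) r p /\ v = last r p.
  by have /connectP[p] := conn r v; exists p.
have [p walk_p] := boolp.choice walk.
exists [ffun v => odd (size (p v)) : nat]; split=> [u v adj_uv|v]; last first.
  by rewrite ffunE; case: odd.
rewrite !ffunE => eq_odd.
have [path_u last_u] := walk_p u; have [path_v last_v] := walk_p v.
(* The closed walk goes from [r] to [u], across the edge to [v], and back. *)
have path_back : path (@adj G) v (rev (belast r (p v))).
  rewrite {1}last_v rev_path (eq_path (e' := @adj G)) // => x y.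
  exact: adj_sym.
case: (@odd_cycle_ucycle (p u ++ v :: rev (belast r (p v)))) => [||s lt2_s cyc_s].
- have last_back : last v (rev (belast r (p v))) = r.
    rewrite {1}last_v; case: (p v) => //= x q.
    by rewrite rev_cons last_rcons.
  rewrite (cycle_path r) last_cat /= last_back cat_path path_u -last_u /=.
  by rewrite adj_uv.
- rewrite size_cat /= size_rev size_belast oddD /=.
  by case: (odd _) (odd _) eq_odd => [] [].
exact: acyc lt2_s cyc_s.
Qed.

End OddCycles.

(* [uphalf n] is the ceiling of n / 2. *)
Theorem theorem39 :
  (forall (n : nat) (G : sgraph), #|G| = n -> bipartite G ->
     (exists v : G, uphalf n < degree v) -> ~ schur_positive G) /\
  (forall (n : nat) (T : sgraph), #|T| = n -> is_tree T ->
     (exists v : T, uphalf n < degree v) -> ~ schur_positive T).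
Proof.
have bip_case (n : nat) (G : sgraph) : #|G| = n -> bipartite G ->
    (exists v : G, uphalf n < degree v) -> ~ schur_positive G.
  move=> <- bip [v lt_v] pos.
  by have := bipartite_degree_le pos bip v; rewrite leqNgt lt_v.
by split=> // n T card_T /tree_bipartite; apply: bip_case.
Qed.
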